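(* For all positive integers $n$ and all $\varepsilon\in(0,1/2)$, $$\mathsf{R}^{\mathsf{pri}}_{\varepsilon}(\mathsf{EQ}_n)\le\log\left(\frac{n}{\varepsilon^2}\right)+4.$$
   Context: All logarithms are base 2. $\mathsf{EQ}_n:\{0,1\}^n\times\{0,1\}^n\to\{0,1\}$ is the Equality function: $\mathsf{EQ}_n(x,y)=1$ iff $x=y$. For $F:\{0,1\}^n\times\{0,1\}^n\to\{0,1\}$, Alice holds $x$, Bob holds $y$, and they run a (possibly interactive) randomized communication protocol in which each player only has private randomness (no shared randomness); at the end a player outputs a bit. The protocol computes $F$ with error $\varepsilon$ if for every $(x,y)$ the output differs from $F(x,y)$ with probability at most $\varepsilon$. The cost of a protocol is the worst-case amount of communication, where sending a message from a set of $B$ possible messages costs $\log B$ (no rounding to an integer number of bits). $\mathsf{R}^{\mathsf{pri}}_{\varepsilon}(F)$ is the minimum cost of such a private-coin protocol computing $F$ with error $\varepsilon$. *)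

(* Defs.v *)
From mathcomp Require Import all_boot all_order all_algebra.
From mathcomp Require Import all_classical all_reals all_analysis.

Set Implicit Arguments.
Unset Strict Implicit.
Unset Printing Implicit Defensive.

Import Order.TTheory GRing.Theory Num.Theory.

Local Open Scope classical_set_scope.
Local Open Scope ring_scope.

Definition log2 (R : realType) (x : R) : R := ln x / ln 2.

(* A protocol tree.  Alice holds an input in X and a random string in A, Bob an
   input in Y and a random string in B.  What a player sends or outputs depends
   only on that player's own input and random string, and on the messages
   exchanged so far, i.e. on the position in the tree.  Each message ranges over
   an arbitrary finite set M, which may vary from node to node.  At a leaf one
   of the two players outputs a bit; the output is not itself communicated. *)
Inductive tree (X Y A B : Type) : Type :=
| AliceSends (M : finType) (msg : X -> A -> M) (next : M -> tree X Y A B)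
| BobSends (M : finType) (msg : Y -> B -> M) (next : M -> tree X Y A B)
| AliceOutputs (out : X -> A -> bool)
| BobOutputs (out : Y -> B -> bool).

Fixpoint output (X Y A B : Type) (t : tree X Y A B)
    (x : X) (y : Y) (a : A) (b : B) : bool :=
  match t with
  | AliceSends M msg next => output (next (msg x a)) x y a b
  | BobSends M msg next => output (next (msg y b)) x y a b
  | AliceOutputs out => out x a
  | BobOutputs out => out y b
  end.

(* The worst case is taken over all root-to-leaf paths.  The default value 0 of
   the maximum is harmless, costs being nonnegative; M is never empty when the
   inputs and random strings range over nonempty types, as msg takes values in
   it. *)
Fixpoint tree_cost (R : realType) (X Y A B : Type) (t : tree X Y A B) : R :=
  match t with
  | AliceSends M msg next =>
      log2 #|M|%:R + \big[Num.max/0]_(m : M) tree_cost R (next m)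
  | BobSends M msg next =>
      log2 #|M|%:R + \big[Num.max/0]_(m : M) tree_cost R (next m)
  | AliceOutputs _ => 0
  | BobOutputs _ => 0
  end.

Record fin_distr (R : realType) (T : finType) := FinDistr {
  pmf :> T -> R;
  pmf_ge0 : forall t, 0 <= pmf t;
  pmf_sum1 : \sum_(t : T) pmf t = 1 }.

(* The players' random strings are independent, each with an arbitrary
   real-valued distribution.  Finite sample spaces lose no generality: when the
   inputs range over finite sets, a random string matters only through the
   player's deterministic strategy in the tree that it selects, and there are
   finitely many of these. *)
Record private_coin_protocol (R : realType) (X Y : Type) := PrivateCoinProtocol {
  alice_coins : finType;
  bob_coins : finType;
  alice_distr : fin_distr R alice_coins;
  bob_distr : fin_distr R bob_coins;
  protocol_tree : tree X Y alice_coins bob_coins }.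

Section Protocols.
Variables (R : realType) (X Y : Type).
Implicit Types (P : private_coin_protocol R X Y) (F : X -> Y -> bool).

Definition cost P : R := tree_cost R (protocol_tree P).

Definition error_prob P F (x : X) (y : Y) : R :=
  \sum_(a : alice_coins P) \sum_(b : bob_coins P
      | output (protocol_tree P) x y a b != F x y)
    alice_distr P a * bob_distr P b.

Definition computes_with_error P F (eps : R) : Prop :=
  forall x y, error_prob P F x y <= eps.

(* For X and Y nonempty this infimum is a minimum whenever some protocol computes F:
   every cost is log2 of a positive integer.  If there were no protocol it would
   be +oo. *)
Definition Rpri (eps : R) F : \bar R :=
  ereal_inf [set c | exists2 P, computes_with_error P F eps & c = (cost P)%:E].

End Protocols.

Definition EQ (n : nat) (x y : n.-tuple bool) : bool := x == y.

(* Main.v *)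
Require Import Defs.
From mathcomp Require Import all_boot all_order all_algebra.
From mathcomp Require Import all_classical all_reals all_analysis.
From mathcomp Require Import ring lra.

(** Fix a code of [2^n] words over [I -> S] any two of which agree on at most an
    [eps] fraction of [I].  Alice sends a uniformly random coordinate of her
    codeword together with its symbol, at cost [log (|I| |S|)], and Bob compares
    with his own codeword; he errs only on distinct inputs, with probability at
    most [eps].  A greedy (Gilbert-Varshamov) choice yields such a code with
    [|I|] about [2n/eps] and [|S|] about [4/eps]: counting the words [w] with
    weight [2^(agreement of w and c)] bounds the number of words that agree with
    [c] too often. *)

Import Order.TTheory GRing.Theory Num.Theory.

Local Open Scope ring_scope.

Definition agreement (I S : finType) (c w : {ffun I -> S}) : {set I} :=
  [set i | c i == w i].

Arguments agreement {I S} c w.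

Lemma agreement_sym (I S : finType) (c w : {ffun I -> S}) :
  agreement c w = agreement w c.
Proof. by apply/setP => i; rewrite !inE eq_sym. Qed.

(** The weight is a product over coordinates, so the sum factors: at each coordinate the symbol of
    [c] contributes 2 and the other [#|S| - 1] symbols contribute 1 each. *)
Lemma sum_exp2_agreement (I S : finType) (c : {ffun I -> S}) :
  (\sum_(w : {ffun I -> S}) 2 ^ #|agreement c w| = #|S|.+1 ^ #|I|)%N.
Proof.
transitivity (\sum_(w : {ffun I -> S}) \prod_i (if c i == w i then 2 else 1))%N.
  apply: eq_bigr => w _; rewrite -big_mkcond /= -prod_nat_const.
  by apply: eq_bigl => i; rewrite inE.
rewrite -(bigA_distr_bigA (fun i s => if c i == s then 2 else 1)%N) /=.
rewrite (eq_bigr (fun=> #|S|.+1)) ?prod_nat_const ?cardE // => i _.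
rewrite (bigD1 (c i)) //= eqxx (eq_bigr (fun=> 1%N)).
  by rewrite sum1_card cardC1 -cardE; case: #|S| (fintype0 (c i)) => // -[].
by move=> s /negPf; rewrite eq_sym => ->.
Qed.

(** While only [k < m] elements are chosen, the sets they exclude cover at most a [k / m] fraction
    of [T], so a further element remains available. *)
Lemma greedy_independent (T : finType) (r : rel T) (m : nat) :
  (0 < #|T|)%N -> (forall c, m * #|[set w | r c w]| <= #|T|)%N ->
  exists2 s : seq T, size s = m & pairwise (fun w c => ~~ r c w) s.
Proof.
move=> T_gt0 small.
suff: forall k, (k <= m)%N ->
    exists2 s : seq T, size s = k & pairwise (fun w c => ~~ r c w) s.
  by apply.
elim=> [_|k IHk ltkm]; first by exists [::].
have [s sz_s pw_s] := IHk (ltnW ltkm).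
pose U := \bigcup_(c <- s) [set w | r c w].
have ltU : (#|U| < #|T|)%N.
  have leU : (#|U| <= \sum_(c <- s) #|[set w | r c w]|)%N.
    rewrite /U; elim: (s) => [|c s' IHs]; first by rewrite !big_nil cards0.
    by rewrite !big_cons (leq_trans (leq_card_setU _ _)) // leq_add2l.
  have leUT : (m * #|U| <= k * #|T|)%N.
    apply: (leq_trans (leq_mul (leqnn m) leU)).
    rewrite big_distrr /= -sz_s -sum1_size big_distrl /=.
    by apply: leq_sum => c _; rewrite mul1n.
  rewrite -(ltn_pmul2l (leq_ltn_trans (leq0n k) ltkm)).
  by rewrite (leq_ltn_trans leUT) // ltn_pmul2r.
have [w wNU] : exists w, w \notin U.
  apply/existsP; rewrite -negb_forall; apply: contraL ltU => /forallP allU.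
  by rewrite -leqNgt; apply/subset_leq_card/fintype.subsetP => w _; apply: allU.
exists (w :: s); rewrite /= ?sz_s // pw_s andbT.
apply/allP => c cs; apply: contra wNU => rcw.
by rewrite /U (big_rem _ cs) /= !inE rcw.
Qed.

Definition uniform_distr {R : realType} {T : finType} (T_gt0 : (0 < #|T|)%N) :
  fin_distr R T.
Proof.
refine (@FinDistr R T (fun=> #|T|%:R^-1) _ _).
  by move=> t; rewrite invr_ge0.
by rewrite sumr_const -[LHS]mulr_natl divff // pnatr_eq0 -lt0n.
Defined.

Lemma log2_le (R : realType) (x y : R) : 0 < x -> x <= y -> log2 x <= log2 y.
Proof.
move=> x_gt0 lexy; rewrite /log2 ler_wpM2r ?invr_ge0 ?ln_ge0 ?ler1n //.
by rewrite ler_ln // posrE // (lt_le_trans x_gt0).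
Qed.

Lemma Rpri_eq_code (R : realType) (X : eqType) (I S : finType) (eps : R)
    (code : X -> {ffun I -> S}) :
  (0 < #|I|)%N -> 0 <= eps ->
  (forall x y, x != y ->
     #|agreement (code x) (code y)|%:R <= eps * #|I|%:R) ->
  (Rpri eps (fun x y : X => x == y) <= (log2 (#|I| * #|S|)%:R)%:E)%E.
Proof.
move=> I_gt0 eps_ge0 far; apply: ereal_inf_lbound.
have unit_gt0 : (0 < #|{: unit}|)%N by rewrite card_unit.
pose t : tree X X I unit :=
  @AliceSends _ _ _ _ (I * S)%type (fun x i => (i, code x i))
    (fun m => BobOutputs _ _ (fun y _ => m.2 == code y m.1)).
exists (@PrivateCoinProtocol R X X I unit (uniform_distr I_gt0)
          (uniform_distr unit_gt0) t); last first.
  have max0 : \big[Num.max/0]_(m : I * S) 0 = 0 :> R.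
    by elim/big_ind: _ => // _ _ -> ->; rewrite maxxx.
  by rewrite /cost /= card_prod max0 addr0.
move=> x y; rewrite /error_prob /= card_unit invr1.
(* Bob's coin takes a single value, so the inner sum is the indicator of an error at coordinate
   [i]. *)
under eq_bigr => i _.
  rewrite big_mkcond /= big_const cardE /= enumT unlock /= addr0 mulr1; over.
rewrite /= -big_mkcond /= sumr_const.
rewrite -[leLHS]mulr_natl ler_pdivrMr ?ltr0n //.
have [->|neqxy] := eqVneq x y.
  by rewrite eq_card0 ?mulr_ge0 // => i; rewrite unfold_in eqxx.
apply: le_trans (far _ _ neqxy).
rewrite ler_nat; apply/subset_leq_card/fintype.subsetP => i.
by rewrite unfold_in inE eqbF_neg negbK.
Qed.

(** Markov's inequality for the weight [2 ^ #|agreement c w|], whose total is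
    [sum_exp2_agreement]. *)
Lemma card_close_le (R : realType) (I S : finType) (c : {ffun I -> S}) (d : R) :
  #|[set w | d < #|agreement c w|%:R]|%:R * 2 `^ d <= (#|S|.+1 ^ #|I|)%:R.
Proof.
rewrite -(sum_exp2_agreement _ _ c) natr_sum -sum1_card natr_sum mulr_suml.
rewrite big_mkcond /=; apply: ler_sum => w _; rewrite inE natrX.
case: ifP => // ltd; rewrite mul1r -powR_mulrn //.
by rewrite ler_powR ?ler1n // ltW.
Qed.

(** This is [ln (1 + x) <= x] at [x = - (1 / 2)]. *)
Lemma ln2_ge_half (R : realType) : 1 / 2 <= ln (2 : R).
Proof.
have := @le_ln1Dx R (- (1 / 2)).
have -> : 1 - 1 / 2 = 2^-1 :> R by lra.
by rewrite lnV ?posrE // lerN2; apply; lra.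
Qed.

Lemma far_code (R : realType) (I S : finType) (n : nat) (eps : R) :
  0 < eps -> 4 <= eps * #|S|%:R -> 2 * n%:R <= eps * #|I|%:R ->
  exists code : n.-tuple bool -> {ffun I -> S}, forall x y, x != y ->
     #|agreement (code x) (code y)|%:R <= eps * #|I|%:R.
Proof.
move=> eps_gt0 leS leI; set d := eps * _.
have S_gt0 : 0 < #|S|%:R :> R by rewrite -(pmulr_rgt0 _ eps_gt0); lra.
have T_gt0 : (0 < #|{ffun I -> S}|)%N.
  by rewrite card_ffun expn_gt0 -(ltr0n R) S_gt0.
pose r := [rel c w : {ffun I -> S} | d < #|agreement c w|%:R].
have r_small c : (#|{: n.-tuple bool}| * #|[set w | r c w]| <= #|{ffun I -> S}|)%N.
  rewrite card_tuple card_bool card_ffun -(ler_nat R) natrM !natrX.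
  (* One factor [2^(d/2)] absorbs the [2^n] codewords, the other absorbs
     [((|S| + 1) / |S|)^|I|]. *)
  have pow_d : 2 `^ d = 2 `^ (d / 2) * 2 `^ (d / 2) :> R.
    by rewrite -powRD ?pnatr_eq0 ?implybT //; congr (_ `^ _); field.
  have le2n : 2 ^+ n <= 2 `^ (d / 2) :> R.
    rewrite -powR_mulrn // ler_powR ?ler1n //; move: leI; rewrite -/d; lra.
  have leSI : (#|S|.+1)%:R ^+ #|I| <= #|S|%:R ^+ #|I| * 2 `^ (d / 2) :> R.
    have -> : d / 2 = eps / 2 * #|I|%:R by rewrite /d; field.
    rewrite powRrM powR_mulrn ?powR_ge0 // -exprMn.
    rewrite lerXn2r ?nnegrE ?mulr_ge0 ?powR_ge0 //.
    (* One coordinate at a time: [2 ^ (eps / 2)] is at least [1 + eps / 2 * ln 2], and this exceeds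
       1 by at least [1 / #|S|] because [eps * #|S| >= 4] and [ln 2 >= 1 / 2]. *)
    apply: (@le_trans _ _ (#|S|%:R * (1 + eps / 2 * ln 2))); last first.
      by rewrite ler_pM2l // /powR pnatr_eq0 /= expR_ge1Dx.
    have : 4 * (1 / 2) <= eps * #|S|%:R * ln 2.
      by apply: ler_pM leS (ln2_ge_half R); lra.
    rewrite -natr1; lra.
  have := card_close_le R I S c d; rewrite natrX => /le_trans/(_ leSI).
  rewrite pow_d mulrA ler_pM2r ?powR_gt0 //; apply: le_trans.
  by rewrite mulrC ler_wpM2l.
have [s sz_s pw_s] := greedy_independent _ r _ T_gt0 r_small.
have [c0 _] : exists c0 : {ffun I -> S}, true by move/card_gt0P: T_gt0 => [c0]; exists c0.
exists (fun x => nth c0 s (enum_rank x)) => x y neqxy.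
(* [pairwise] only compares an earlier entry with a later one; symmetry of agreement covers the
   other order. *)
wlog ltxy : x y neqxy / (enum_rank x < enum_rank y)%N.
  move=> Hw; case: (ltngtP (enum_rank x) (enum_rank y)) => [|?|/val_inj/enum_rank_inj eqxy].
  - exact: Hw.
  - by rewrite agreement_sym; apply: Hw; rewrite // eq_sym.
  - by rewrite eqxy eqxx in neqxy.
have /(_ (enum_rank x) (enum_rank y)) := pairwiseP c0 pw_s.
by rewrite !inE sz_s !ltn_ord -leNgt agreement_sym => /(_ isT isT ltxy).
Qed.

Lemma exists_nat_between (R : realType) (x : R) :
  0 <= x -> exists2 k : nat, x <= k%:R & k%:R <= x + 1.
Proof.
move=> x_ge0; exists (Num.truncn x).+1; first exact/ltW/truncnS_gt.
by rewrite -natr1 lerD2r; have /andP[] := truncn_itv x_ge0.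
Qed.

Theorem theorem1p7 (R : realType) (n : nat) (eps : R) :
  (0 < n)%N -> 0 < eps -> eps < 1 / 2 ->
  (Rpri eps (@EQ n) <= (log2 (n%:R / eps ^+ 2) + 4)%:E)%E.
Proof.
move=> n_gt0 eps_gt0 eps_lt.
have n_ge1 : 1 <= n%:R :> R by rewrite ler1n.
have inv_ge2 : 2 <= eps^-1 by rewrite -[leLHS]invrK lef_pV2 ?posrE //; lra.
have [N leN Nle] := exists_nat_between R (2 * n%:R / eps)
  ltac:(rewrite divr_ge0 ?mulr_ge0 // ltW //).
have [q leq_q q_le] := exists_nat_between R (4 / eps) ltac:(rewrite divr_ge0 // ltW //).
have N_gt0 : (0 < N)%N.
  by rewrite -(ltr0n R) (lt_le_trans _ leN) // divr_gt0 // mulr_gt0 // ltr0n.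
have q_gt0 : (0 < q)%N by rewrite -(ltr0n R) (lt_le_trans _ leq_q) // divr_gt0.
have [|||code far] := far_code R 'I_N 'I_q n eps; rewrite ?card_ord //.
- by rewrite [leRHS]mulrC -ler_pdivrMr.
- by rewrite [leRHS]mulrC -ler_pdivrMr.
have := Rpri_eq_code R _ _ _ eps code _ (ltW eps_gt0) far.
rewrite !card_ord => /(_ N_gt0)/le_trans; apply; rewrite lee_fin.
(* The additive 4 leaves a factor 16 for [N * q]. *)
have ->: log2 (n%:R / eps ^+ 2) + 4 = log2 (2 ^+ 4 * (n%:R / eps ^+ 2)).
  have : 0 < n%:R / eps ^+ 2 by rewrite divr_gt0 ?exprn_gt0 ?ltr0n.
  move: (n%:R / eps ^+ 2) => y y_gt0.
  have ln2_gt0 : 0 < ln (2 : R) by have := ln2_ge_half R; lra.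
  rewrite /log2 lnM ?posrE ?exprn_gt0 // lnXn //.
  by field; rewrite gt_eqF.
apply: log2_le; first by rewrite ltr0n muln_gt0 N_gt0.
(* Rounding up adds at most 1, which is at most half of [n / eps] and half of [1 / eps], since both
   are at least 2. The constants multiply to [45 / 4 <= 16]. *)
have leN' : N%:R <= 5 / 2 * (n%:R / eps).
  have : 1 * 2 <= n%:R / eps by apply: ler_pM => //; lra.
  lra.
have leq' : q%:R <= 9 / 2 * eps^-1 by lra.
rewrite natrM; apply: le_trans (ler_pM _ _ leN' leq') _; rewrite ?ler0n //.
have -> : 5 / 2 * (n%:R / eps) * (9 / 2 * eps^-1) = 45 / 4 * (n%:R / eps ^+ 2).
  by field; rewrite gt_eqF.
by rewrite ler_wpM2r ?divr_ge0 ?exprn_ge0 ?ltW //; lra.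
Qed.
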